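(* Let $X$ be a non-empty set. The elements of $\mathsf{FFR}_s(X)$ can be identified with the pairs $(\Gamma,a)\in M(X^*,X\cup\overline{X^*})$ where $\Gamma$ is a $\rho_s$-closed subgraph of $\mathrm{Cay}(X^*,X\cup\overline{X^*})$, equipped with the operations $$(\Gamma,a)(\Delta,b)=((\Gamma\cup a\Delta)^{\wedge_s},ab),\qquad (\Gamma,a)^+=(\Gamma,\lambda),\qquad (\Gamma,a)^{\mathfrak{m}}=(\Gamma_{\overline{a}}^{\wedge_s},a).$$ That is, the set of these pairs with these operations and with the constant $(\Gamma_{\overline{\lambda}},\lambda)$ is $X$-canonically $(\cdot,{}^+,{}^{\mathfrak{m}},\lambda)$-isomorphic to $\mathsf{FFR}_s(X)$, where the generator $x\in X$ corresponds to $(\Gamma_x^{\wedge_s},x)$.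
   Context: A restriction semigroup is an algebra $(R;\cdot,{}^+)$ of type $(2,1)$ such that $(R;\cdot)$ is a semigroup and the identities $x^+x=x$, $x^+y^+=y^+x^+$, $(x^+y)^+=x^+y^+$, $xy^+=(xy)^+x$ hold. Its set of projections is $P(R)=\{s^+ : s\in R\}$. The natural partial order is $s\le t$ iff $s=et$ for some $e\in P(R)$. The congruence $\sigma$ is the minimum congruence identifying all projections: $s\mathrel{\sigma}t$ iff $es=et$ for some $e\in P(R)$. An $F$-restriction semigroup is a restriction semigroup in which every $\sigma$-class has a maximum element with respect to $\le$; the maximum element of the $\sigma$-class of $s$ is denoted $s^{\mathfrak{m}}$. It has a maximum projection, denoted $\lambda$, which is its unique left identity. It is strong if $s^{\mathfrak{m}}t^{\mathfrak{m}}=(s^{\mathfrak{m}})^+(st)^{\mathfrak{m}}$ for all $s,t$. Strong $F$-restriction semigroups, regarded as algebras in the signature $(\cdot,{}^+,{}^{\mathfrak{m}},\lambda)$ of type $(2,1,1,0)$, form a variety, and $\mathsf{FFR}_s(X)$ denotes its free $X$-generated object. A morphism of $X$-generated algebras is $X$-canonical if it commutes with the assignment maps from $X$. $X^*$ is the free monoid on $X$ with identity $\lambda$, and $\overline{X^*}=\{\overline{u}:u\in X^*\}$ is a disjoint bijective copy of $X^*$. The Cayley graph $\mathrm{Cay}(X^*,X\cup\overline{X^*})$ has vertex set $X^*$ and labeled directed edges $(w,x,wx)$ and $(w,\overline{u},wu)$ for $w\in X^*$, $x\in X$, $u\in X^*$. A subgraph is accessible if it contains the vertex $\lambda$ and each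 of its vertices is reachable by a directed path in the subgraph from $\lambda$. $M(X^*,X\cup\overline{X^*})$ is the set of all pairs $(\Gamma,a)$ where $\Gamma$ is a finite accessible subgraph of $\mathrm{Cay}(X^*,X\cup\overline{X^*})$ with at least one edge and $a$ is a vertex of $\Gamma$. For a subgraph $\Delta$ and $a\in X^*$, $a\Delta$ is the left translate of $\Delta$ by $a$. For $y\in X\cup\overline{X^*}$, $\Gamma_y$ is the subgraph consisting of the single edge with label $y$ starting at $\lambda$, together with its endpoints. For a finite accessible subgraph $\Gamma$ with at least one edge, consider the transformations (with $u,v,w\in X^*$): ($T_1$) if $\Gamma$ has an edge $(v,\overline{u},vu)$ but not the edge $(v,\overline{\lambda},v)$, add the edge $(v,\overline{\lambda},v)$; ($T_2$) if $\Gamma$ has an edge $(v,x,vx)$ with $x\in X$ but not the edge $(v,\overline{x},vx)$, add the edge $(v,\overline{x},vx)$; ($T_3$) if $\Gamma$ has edges $(w,\overline{u},wu)$ and $(wu,\overline{v},wuv)$ but not the edge $(w,\overline{uv},wuv)$, add the edge $(w,\overline{uv},wuv)$; ($T_4$) if $\Gamma$ has edges $(w,\overline{u},wu)$ and $(w,\overline{uv},wuv)$ but not the edge $(wu,\overline{v},wuv)$, add the edge $(wu,\overline{v},wuv)$. $\Gamma^{\wedge_s}$ denotes the finite graph obtained from $\Gamma$ by applying these transformations until none of them is applicable (the process terminates and the result does not depend on the choices). $\Gamma$ is called $\rho_s$-closed if $\Gamma=\Gamma^{\wedge_s}$. *)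

(* Defs.v *)
From Stdlib Require Import Relation_Definitions Relation_Operators.
From HB Require Import structures.
From mathcomp Require Import all_boot.
From mathcomp Require Import boolp classical_sets cardinality.

Set Implicit Arguments.
Unset Strict Implicit.
Unset Printing Implicit Defensive.

Local Open Scope classical_set_scope.

Record algebra := Algebra {
  car :> Type;
  mul : car -> car -> car;
  plus : car -> car;
  mmax : car -> car;
  lam : car }.

Section Restriction.
Variables (T : Type) (m : T -> T -> T) (p : T -> T).

Record restriction_semigroup : Prop := RestrictionSemigroup {
  rs_assoc : associative m;
  rs_plusx : forall x, m (p x) x = x;
  rs_plusC : forall x y, m (p x) (p y) = m (p y) (p x);
  rs_plusM : forall x y, p (m (p x) y) = m (p x) (p y);
  rs_ample : forall x y, m x (p y) = m (p (m x y)) x }.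

Definition projection : set T := range p.

Definition natural_le (s t : T) : Prop := exists2 e, projection e & s = m e t.

Record congruence (r : relation T) : Prop := Congruence {
  cong_equiv : equivalence T r;
  cong_mul : forall s s' t t', r s s' -> r t t' -> r (m s t) (m s' t');
  cong_plus : forall s s', r s s' -> r (p s) (p s') }.

Definition identifies_projections (r : relation T) : Prop :=
  forall e f, projection e -> projection f -> r e f.

Definition sigma (s t : T) : Prop :=
  forall r, congruence r -> identifies_projections r -> r s t.

Definition max_of_sigma_class (s t : T) : Prop :=
  sigma s t /\ forall u, sigma s u -> natural_le u t.

Definition max_projection (e : T) : Prop :=
  projection e /\ forall f, projection f -> natural_le f e.

Lemma sigmaP : restriction_semigroup ->
  forall s t, sigma s t <-> exists2 e, projection e & m e s = m e t.
Proof.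
move=> [mA px pC pM pA] s t.
have pp x : m (p x) (p x) = p x by rewrite -pM px.
have mp x y : projection (m (p x) (p y)) by exists (m (p x) y).
split; last first.
  move=> [e Pe est] r [[rr rt rs] rm _] rid.
  have reds u : r (m e u) u.
    by rewrite -{2}(px u); apply: rm => //; apply: rid => //; exists u.
  apply: rt (reds t); rewrite -est; exact: rs.
move=> st; apply: (st (fun x y => exists2 e, projection e & m e x = m e y)).
  2: move=> _ _ [x _ <-] [y _ <-]; exists (m (p x) (p y)) => //;
    by rewrite -!mA pp [m (p y) (p x)]pC mA pp.
split.
- split.
  + by move=> x; exists (p x) => //; exists x.
  + move=> x y z [_ [a _ <-] xy] [_ [b _ <-] yz]; exists (m (p a) (p b)) => //.
    by rewrite {1}pC -!mA xy -yz !mA [m (p b) _]pC.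
  + by move=> x y [e Pe xy]; exists e.
- move=> x x' y y' [_ [a _ <-] xx'] [_ [b _ <-] yy'].
  exists (m (p a) (p (m x b))) => //.
  have h c : m (m (p a) (p (m x b))) (m x' c)
           = m (p a) (m x (m (p b) c)).
    rewrite [m (p a) (p _)]pC -mA [m (p a) (m x' c)]mA -xx' -mA.
    by rewrite mA pC -mA [m (p (m x b)) _]mA -pA -mA.
  rewrite h -yy' -mA; congr (m (p a) _).
  by rewrite [LHS]mA -pA -mA.
- move=> x x' [_ [a _ <-] xx']; exists (p a); first by exists a.
  by rewrite -!pM xx'.
Qed.

End Restriction.

(* [mmax] and [lam] are not extra data: the axioms determine them from the
   restriction semigroup reduct, which is then F-restriction. *)
Record strong_F_restriction (A : algebra) : Prop := StrongFRestriction {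
  sfr_restriction : restriction_semigroup (@mul A) (@plus A);
  sfr_mmax : forall s : A,
    max_of_sigma_class (@mul A) (@plus A) s (mmax s);
  sfr_lam : max_projection (@mul A) (@plus A) (lam A);
  sfr_strong : forall s t : A,
    mul (mmax s) (mmax t) = mul (plus (mmax s)) (mmax (mul s t)) }.

Record morphism (A B : algebra) (h : A -> B) : Prop := Morphism {
  mor_mul : forall s t, h (mul s t) = mul (h s) (h t);
  mor_plus : forall s, h (plus s) = plus (h s);
  mor_mmax : forall s, h (mmax s) = mmax (h s);
  mor_lam : h (lam A) = lam B }.

(* [A] with assignment map [i] is the free [X]-generated strong F-restriction
   semigroup, i.e. is FFR_s(X). *)
Definition is_FFRs (X : Type) (A : algebra) (i : X -> A) : Prop :=
  strong_F_restriction A /\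
  forall B : algebra, strong_F_restriction B -> forall f : X -> B,
    exists! h : A -> B, morphism h /\ forall x, h (i x) = f x.

Definition canonical_isomorphism (X : Type) (A B : algebra)
    (i : X -> A) (j : X -> B) (h : A -> B) : Prop :=
  [/\ morphism h, bijective h & forall x, h (i x) = j x].

Section Graphs.
Variable X : Type.

Definition word := seq X.

(* [inl x] is the letter x, [inr u] is the label u-bar. *)
Definition label := (X + word)%type.

Definition label_word (y : label) : word :=
  match y with inl x => [:: x] | inr u => u end.

Definition edge := (word * label * word)%type.
Definition src (e : edge) : word := e.1.1.
Definition tgt (e : edge) : word := e.2.

Definition cay_edge (w : word) (y : label) : edge := (w, y, w ++ label_word y).
Definition xedge (w : word) (x : X) : edge := cay_edge w (inl x).
Definition bedge (w u : word) : edge := cay_edge w (inr u).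

Record graph := Graph { verts : set word; edges : set edge }.

HB.instance Definition _ := gen_eqMixin graph.
HB.instance Definition _ := gen_choiceMixin graph.

Definition Cay : graph :=
  Graph setT [set e | exists w y, e = cay_edge w y].

Definition subgraph (G H : graph) : Prop :=
  [/\ verts G `<=` verts H, edges G `<=` edges H &
      forall e, edges G e -> verts G (src e) /\ verts G (tgt e)].

Definition finite_graph (G : graph) : Prop :=
  finite_set (verts G) /\ finite_set (edges G).

Definition reachable (G : graph) : word -> word -> Prop :=
  clos_refl_trans word (fun v w => exists y, edges G (v, y, w)).

Definition accessible (G : graph) : Prop :=
  verts G [::] /\ forall v, verts G v -> reachable G [::] v.

Definition in_M (q : graph * word) : Prop :=
  [/\ subgraph q.1 Cay, finite_graph q.1, accessible q.1,
      edges q.1 !=set0 & verts q.1 q.2].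

Definition union (G H : graph) : graph :=
  Graph (verts G `|` verts H) (edges G `|` edges H).

Definition translate (a : word) (G : graph) : graph :=
  Graph [set a ++ v | v in verts G]
        [set (a ++ src e, e.1.2, a ++ tgt e) | e in edges G].

Definition edge_graph (y : label) : graph :=
  Graph [set [::]; label_word y] [set cay_edge [::] y].

(* In each use below both endpoints of [e] already are vertices of [G]. *)
Definition add_edge (G : graph) (e : edge) : graph :=
  Graph (verts G) (edges G `|` [set e]).

Inductive transform (G : graph) : graph -> Prop :=
| T1 v u : edges G (bedge v u) -> ~ edges G (bedge v [::]) ->
    transform G (add_edge G (bedge v [::]))
| T2 v x : edges G (xedge v x) -> ~ edges G (bedge v [:: x]) ->
    transform G (add_edge G (bedge v [:: x]))
| T3 w u v : edges G (bedge w u) -> edges G (bedge (w ++ u) v) ->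
    ~ edges G (bedge w (u ++ v)) ->
    transform G (add_edge G (bedge w (u ++ v)))
| T4 w u v : edges G (bedge w u) -> edges G (bedge w (u ++ v)) ->
    ~ edges G (bedge (w ++ u) v) ->
    transform G (add_edge G (bedge (w ++ u) v)).

Definition closes_to (G H : graph) : Prop :=
  clos_refl_trans graph transform G H /\ forall K, ~ transform H K.

(* [xget] picks the result of the process; its default value [G] is irrelevant
   for finite subgraphs of [Cay], where the process terminates, with a result
   that does not depend on the choices. *)
Definition rho_closure (G : graph) : graph := xget G [set H | closes_to G H].

Definition rho_closed (G : graph) : Prop := G = rho_closure G.

Definition closed_pair : Type :=
  {q : graph * word | in_M q /\ rho_closed q.1}.

Definition pair_mul (p q : graph * word) : graph * word :=
  (rho_closure (union p.1 (translate p.2 q.1)), p.2 ++ q.2).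

Definition pair_plus (p : graph * word) : graph * word := (p.1, [::]).

Definition pair_mmax (p : graph * word) : graph * word :=
  (rho_closure (edge_graph (inr p.2)), p.2).

Definition pair_lam : graph * word := (edge_graph (inr [::]), [::]).

Definition pair_gen (x : X) : graph * word :=
  (rho_closure (edge_graph (inl x)), [:: x]).

End Graphs.

Arguments pair_lam {X}.

(* [A] is the set of closed pairs with the operations of pairs; [sval] is
   injective, so the equations determine [A] and [i]. *)
Record closed_pair_algebra (X : Type)
    (m : closed_pair X -> closed_pair X -> closed_pair X)
    (p mm : closed_pair X -> closed_pair X) (l : closed_pair X)
    (i : X -> closed_pair X) : Prop := ClosedPairAlgebra {
  cpa_mul : forall s t, sval (m s t) = pair_mul (sval s) (sval t);
  cpa_plus : forall s, sval (p s) = pair_plus (sval s);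
  cpa_mmax : forall s, sval (mm s) = pair_mmax (sval s);
  cpa_lam : sval l = pair_lam;
  cpa_gen : forall x, sval (i x) = pair_gen x }.

(* Main.v *)
From Stdlib Require Import Relation_Operators Operators_Properties.
From Stdlib Require List.
From mathcomp Require Import all_boot.
From mathcomp Require Import boolp classical_sets cardinality.
Require Import Defs.

Set Implicit Arguments.
Unset Strict Implicit.
Unset Printing Implicit Defensive.

Local Open Scope classical_set_scope.

(** The outcome of the transformations is the least set of edges that contains
    the given ones and is saturated, that is, stable under the four rules
    ([closes_to_hull], [rho_closureE]). Taking this hull is a closure operator
    compatible with unions and translates, so the restriction semigroup
    identities for pairs reduce to identities for unions of graphs. Two pairs
    are sigma-related iff their second components agree ([cp_sigmaP]), and in
    a closed accessible graph with an edge every vertex [v] is the end of the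
    copied edge from the root labelled by [v] ([bar_edge]); so the pair
    generated by the edge from the root labelled by the copy of [a] is the
    largest one over [a]. Strongness amounts to this: in the triangle [::],
    [a], [a ++ b] of copied edges, the side from [::] to [a] and either of the
    other two sides generate the remaining one ([hull_union_bar]).

    For freeness, let [f] map [X] to a strong F-restriction semigroup [B], and
    let [top w] be the largest element of the sigma-class of the product of
    the letters of [w]; strongness becomes [top u ** top v = plus (top u) **
    top (u ++ v)] ([top_mul]). An edge from [w] whose label has the value [y]
    is sent to the projection [plus (top w ** y)], a graph to the product of
    the projections of its edges, and [(G, a)] to the value of [G] times [top
    a]. A copied edge from [w] to [v] has value [plus (top w) ** plus (top
    v)], so for each projection [g] the edges whose value is above [g] form a
    saturated set ([saturated_below]); hence a graph and its closure have the
    same lower bounds, and therefore equal values. Translating a graph by [a]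
    amounts to multiplying by [top a] ([top_mul_edge_value]), which makes the
    map multiplicative.

    Uniqueness follows from applying this evaluation to the algebra of closed
    pairs itself: there every pair is its own value ([cp_edges_value],
    [cp_decompose]), so it is an expression in the generators, and morphisms
    commute with evaluation. *)

(** * Saturated edge sets and the closure of a graph *)

Lemma finite_set_list (T : Type) (A : set T) :
  finite_set A -> exists s : seq T, forall x, A x <-> List.In x s.
Proof.
have InP (s : seq {classic T}) x : x \in s <-> List.In x s.
  elim: s => //= y s IHs; rewrite inE; split.
    by case/orP => [/eqP ->|/IHs]; [left|right].
  by case=> [->|/IHs ->]; rewrite ?eqxx ?orbT.
case/(@finite_seqP {classic T}) => s ->; exists s => x; exact: InP.
Qed.

Section Closure.
Variable X : Type.
Implicit Types (G H : graph X) (E : set (edge X)) (a v w : word X).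

Lemma graph_eq G H : verts G = verts H -> edges G = edges H -> G = H.
Proof. by case: G H => [V E] [V' E'] /= -> ->. Qed.

Record saturated E : Prop := Saturated {
  sat_loop v u : E (bedge v u) -> E (bedge v [::]);
  sat_bar v x : E (xedge v x) -> E (bedge v [:: x]);
  sat_comp w u v :
    E (bedge w u) -> E (bedge (w ++ u) v) -> E (bedge w (u ++ v));
  sat_quot w u v :
    E (bedge w u) -> E (bedge w (u ++ v)) -> E (bedge (w ++ u) v) }.

(** Saturated sets are stable under intersection, so the least one above the
    edges of [G] has a direct description, which does not refer to any
    sequence of transformations. *)
Definition hull G : graph X :=
  Graph (verts G)
    [set e | forall E, saturated E -> edges G `<=` E -> E e].

Lemma saturated_hull G : saturated (edges (hull G)).
Proof.
split=> [v u h|v x h|w u v h h'|w u v h h'] E sE GE.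
- exact: (sat_loop sE (h _ sE GE)).
- exact: (sat_bar sE (h _ sE GE)).
- exact: (sat_comp sE (h _ sE GE) (h' _ sE GE)).
- exact: (sat_quot sE (h _ sE GE) (h' _ sE GE)).
Qed.

Lemma sub_hull G : edges G `<=` edges (hull G).
Proof. by move=> e Ge E _; apply. Qed.

Lemma hull_sub G E : saturated E -> edges G `<=` E -> edges (hull G) `<=` E.
Proof. by move=> sE GE e; apply. Qed.

Lemma hull_eq G H : verts G = verts H ->
  edges G `<=` edges (hull H) -> edges H `<=` edges (hull G) ->
  hull G = hull H.
Proof.
move=> VV GH HG; apply: graph_eq => //.
by apply/seteqP; split; apply: hull_sub => //; apply: saturated_hull.
Qed.

Lemma hull_id G : saturated (edges G) -> hull G = G.
Proof.
move=> sG; apply: graph_eq => //; apply/seteqP; split; first exact: hull_sub.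
exact: sub_hull.
Qed.

(** The vertices of a graph bound its closure: a new edge is determined by
    its two endpoints, which are old. *)
Let candidate G : set (edge X) :=
  [set e | [/\ verts G (src e), verts G (tgt e) &
               edges G e \/ exists v u, e = bedge v u]].

Let saturated_candidate G :
  subgraph G (Cay X) -> saturated (candidate G).
Proof.
move=> [_ _ Gv]; split.
- move=> v u [Gs _ _]; split => //; first by rewrite /tgt /= cats0.
  by right; exists v, [::].
- by move=> v x [Gs Gt _]; split => //; right; exists v, [:: x].
- move=> w u v [Gs _ _] [_ Gt _]; split => //; last by right; exists w, (u ++ v).
  by rewrite /tgt /= catA; exact: Gt.
- move=> w u v [_ Gs _] [_ Gt _]; split => //.
    by rewrite /tgt /= -catA; exact: Gt.
  by right; exists (w ++ u), v.
Qed.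

Let hull_candidate G : subgraph G (Cay X) ->
  edges (hull G) `<=` candidate G.
Proof.
move=> sG; apply: hull_sub; first exact: saturated_candidate.
by case: sG => _ _ Gv e Ge; case: (Gv e Ge) => Gs Gt; split => //; left.
Qed.

Lemma subgraph_hull G : subgraph G (Cay X) -> subgraph (hull G) (Cay X).
Proof.
move=> sG; split => // e /(hull_candidate sG) [Gs Gt] //.
case=> [Ge|[v [u ->]]]; first by case: sG => _ + _; apply.
by exists v, (inr u).
Qed.

Lemma finite_hull G : subgraph G (Cay X) -> finite_graph G ->
  finite_graph (hull G).
Proof.
move=> sG [fV fE]; split => //.
have fVV := finite_setX fV fV.
pose F := (fun p : word X * word X => bedge p.1 (drop (size p.1) p.2)).
apply: sub_finite_set (_ : finite_set (edges G `|` F @` (verts G `*` verts G))).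
  move=> e /(hull_candidate sG) [Gs Gt [Ge|[v [u def_e]]]]; first by left.
  right; exists (v, v ++ u); first by rewrite def_e in Gs Gt; split.
  by rewrite /F /= drop_size_cat.
by rewrite finite_setU; split => //; exact: finite_image.
Qed.

Lemma transform_add G H : transform G H ->
  exists e, [/\ H = add_edge G e, edges (hull G) e & ~ edges G e].
Proof.
have sG := saturated_hull G; have Gh := @sub_hull G.
case=> [v u e1|v x e1|w u v e1 e2|w u v e1 e2] ne.
- exists (bedge v [::]); split => //; apply: (sat_loop sG (Gh _ e1)).
- exists (bedge v [:: x]); split => //; apply: (sat_bar sG (Gh _ e1)).
- by exists (bedge w (u ++ v)); split => //; apply: (sat_comp sG); apply: Gh.
- by exists (bedge (w ++ u) v); split => //; apply: (sat_quot sG); apply: Gh.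
Qed.

Lemma hull_transform G H : transform G H -> hull H = hull G.
Proof.
case/transform_add => e [-> Ge _]; apply: hull_eq => //= e'.
  by case=> [|->] //; apply: sub_hull.
by move=> Ge' E _; apply; left.
Qed.

Lemma saturated_terminal G : (forall H, ~ transform G H) <-> saturated (edges G).
Proof.
split=> [tG|sG H].
  split=> *; apply: contrapT => ne.
  - by apply: tG; apply: T1 ne; eassumption.
  - by apply: tG; apply: T2 ne; eassumption.
  - by apply: tG; apply: T3 ne; eassumption.
  - by apply: tG; apply: T4 ne; eassumption.
by case/transform_add => e [_]; rewrite hull_id.
Qed.

(** Confluence: every transformation preserves the hull, and the process only
    stops at a saturated graph, which is its own hull. *)
Lemma closes_to_hull G H : closes_to G H -> H = hull G.
Proof.
case=> GH /saturated_terminal sH; rewrite -(hull_id sH).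
by elim: GH {sH} => // [K L /hull_transform|K L M _ -> _ ->].
Qed.

(** Termination: each step consumes one of the finitely many edges that the
    hull has in excess. *)
Lemma closes_to_exists G : finite_graph (hull G) -> exists H, closes_to G H.
Proof.
case=> _ /finite_set_list [s hs].
have {hs} : forall e, edges (hull G) e -> edges G e \/ List.In e s.
  by move=> e /hs; right.
have [n] := ubnP (size s); elim: n s G => // n IHn s G /ltnSE le_s hs.
have [[H GH]|tG] := pselect (exists H, transform G H); last first.
  exists G; split; first exact: rt_refl.
  by move=> H GH; apply: tG; exists H.
have hullH := hull_transform GH.
have [e [def_H he ne]] := transform_add GH.
have [//|ein] := hs e he; have [s1 [s2 def_s]] := List.in_split _ _ ein.
have [||K [HK tK]] := IHn (s1 ++ s2) H.
- by apply: leq_trans le_s; rewrite def_s !size_cat /= addnS.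
- rewrite hullH def_H => e' /hs [Ge'|]; first by left; left.
  rewrite def_s => in12; case: (List.in_app_or _ _ _ in12) => [i1|[<-|i2]].
  + by right; apply: List.in_or_app; left.
  + by left; right.
  + by right; apply: List.in_or_app; right.
by exists K; split => //; apply: rt_trans HK; apply: rt_step.
Qed.

Lemma rho_closureE G : subgraph G (Cay X) -> finite_graph G ->
  rho_closure G = hull G.
Proof.
move=> sG fG; apply: closes_to_hull.
exact: (xgetPex G (closes_to_exists (finite_hull sG fG))).
Qed.

(** * Unions and translates *)

Definition shift a (e : edge X) : edge X := (a ++ src e, e.1.2, a ++ tgt e).

Lemma shift_cay a w y : shift a (cay_edge w y) = cay_edge (a ++ w) y.
Proof. by rewrite /shift /tgt /cay_edge /= catA. Qed.

Lemma saturated_shift a E : saturated E -> saturated (shift a @^-1` E).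
Proof.
move=> sE; split=> [v u|v x|w u v|w u v]; rewrite /preimage /= !shift_cay.
- exact: (sat_loop sE).
- exact: (sat_bar sE).
- by rewrite catA; exact: (sat_comp sE).
- by rewrite catA; exact: (sat_quot sE).
Qed.

Lemma translate_hull a G :
  edges (translate a (hull G)) `<=` edges (hull (translate a G)).
Proof.
move=> _ [e he <-] E sE GE.
by apply: (he _ (saturated_shift a sE)) => e' Ge'; apply: GE; exists e'.
Qed.

Lemma hull_unionl G H : hull (union (hull G) H) = hull (union G H).
Proof.
apply: hull_eq => //= e; case=> he E sE GE.
- by apply: he => // e' Ge'; apply: GE; left.
- by apply: GE; right.
- by apply: GE; left; apply: sub_hull.
- by apply: GE; right.
Qed.

Lemma unionC G H : union G H = union H G.
Proof. by rewrite /union setUC [edges G `|` _]setUC. Qed.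

Lemma unionA G H K : union G (union H K) = union (union G H) K.
Proof. by rewrite /union /= !setUA. Qed.

Lemma unionid G : union G G = G.
Proof. by apply: graph_eq; rewrite /= setUid. Qed.

Lemma hull_unionr G H : hull (union G (hull H)) = hull (union G H).
Proof. by rewrite unionC hull_unionl unionC. Qed.

Lemma hull_union_translate G a H :
  hull (union G (translate a (hull H))) = hull (union G (translate a H)).
Proof.
apply: hull_eq => // e; case=> he E sE GE.
- by apply: GE; left.
- by apply: (translate_hull he) => // e' Ge'; apply: GE; right.
- by apply: GE; left.
- by apply: GE; right; case: he => e' Ge' <-; exists e' => //; apply: sub_hull.
Qed.

Lemma translate0 G : translate [::] G = G.
Proof.
apply: graph_eq; first by rewrite /= image_id.
by apply/seteqP; split=> [_ [[[? ?] ?] ? <-] //|[[v y] w] Ge]; exists (v, y, w).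
Qed.

Lemma translate_union a G H :
  translate a (union G H) = union (translate a G) (translate a H).
Proof. by apply: graph_eq; rewrite /= image_setU. Qed.

Lemma translate_cat a b G : translate (a ++ b) G = translate a (translate b G).
Proof.
apply: graph_eq; rewrite /= image_comp; apply: eq_imagel => x _ /=.
  by rewrite catA.
by rewrite /src /tgt /= !catA.
Qed.

(** Composition and cancellation of copied edges exchange two sides of the
    triangle with vertices [::], [a] and [a ++ b], in the presence of the side from
    [::] to [a]. *)
Lemma hull_union_bar a b :
  hull (union (edge_graph (inr a)) (translate a (edge_graph (inr b)))) =
  hull (union (edge_graph (inr a)) (edge_graph (inr (a ++ b)))).
Proof.
have shiftE : shift a (cay_edge [::] (inr b)) = bedge a b.
  by rewrite shift_cay cats0.
apply: hull_eq.
- rewrite [LHS]/= [RHS]/= image_setU !image_set1 cats0.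
  by apply/seteqP; split=> v [[]|[]] ->;
    [left; left|left; right|left; right|right; right
    |left; left|left; right|left; left|right; right].
- move=> e [->|[_ -> <-]] E sE GE; first by apply: GE; left.
  rewrite -/(shift _ _) shiftE.
  by apply: (sat_quot (w := [::]) (u := a) sE); apply: GE; [left|right].
- move=> e [->|->] E sE GE; first by apply: GE; left.
  apply: (sat_comp (w := [::]) (u := a) sE); apply: GE; first by left.
  by right; exists (cay_edge [::] (inr b)) => //; exact: shiftE.
Qed.

(** * Accessible graphs *)

Lemma cay_tgt G e : subgraph G (Cay X) -> edges G e ->
  e = cay_edge (src e) e.1.2.
Proof. by case=> _ sE _ /sE [w [y ->]]. Qed.

Lemma reachable_sub G H v w :
  edges G `<=` edges H -> reachable G v w -> reachable H v w.
Proof.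
move=> GH; elim=> [a b [y Ge]|a|a b c _ IH _]; first last.
- exact: rt_trans IH.
- exact: rt_refl.
- by apply: rt_step; exists y; apply: GH.
Qed.

Lemma reachable_translate a G v w :
  reachable G v w -> reachable (translate a G) (a ++ v) (a ++ w).
Proof.
elim=> [b c [y Ge]|b|b c d _ IH _]; first last.
- exact: rt_trans IH.
- exact: rt_refl.
- by apply: rt_step; exists y; exists (b, y, c).
Qed.

(** In a saturated accessible graph the directed path from the root to [a]
    composes to a single edge labelled by the copy of [a]; this is why the pair
    with graph generated by that edge is above all others ending in [a]. *)
Lemma bar_edge G a : in_M (G, a) -> saturated (edges G) ->
  forall v, verts G v -> edges G (bedge [::] v).
Proof.
move=> [/= sG _ [_ acc] [e0 Ge0] _] sE.
have bar w y : edges G (cay_edge w y) -> edges G (bedge w (label_word y)).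
  by case: y => // x /(sat_bar sE).
have root : edges G (bedge [::] [::]).
  (* The root has an outgoing edge: the first one on a path to the source of [e0],
     or [e0] itself if that path is empty. *)
  have [w [y Ge]] : exists w y, edges G ([::], y, w).
    have [Vs _] : verts G (src e0) /\ verts G (tgt e0) by case: sG => _ _; apply.
    have : src e0 = [::] \/ exists w y, edges G ([::], y, w).
      case: (clos_rt_rt1n _ _ _ _ (acc _ Vs)); first by left.
      by move=> w z [y Ge] _; right; exists w, y.
    case=> // e0E; exists (tgt e0), e0.1.2; rewrite -e0E.
    by case: e0 Ge0 {Vs e0E} => [[]].
  move: (Ge); rewrite (cay_tgt sG Ge) => /bar; exact: (sat_loop sE).
move=> v /acc r; elim: (clos_rt_rtn1 _ _ _ _ r) => // b c [y Ge] _ IH.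
have def_c := cay_tgt sG Ge; move: (Ge); rewrite def_c => /bar.
case: def_c => ->; exact: (sat_comp sE IH).
Qed.

Lemma in_M_hull G a : in_M (G, a) -> in_M (hull G, a).
Proof.
move=> [/= sG fG [G0 acc] [e Ge] Ga]; split => //=.
- exact: subgraph_hull.
- exact: finite_hull.
- split=> // v /acc; apply: reachable_sub; exact: sub_hull.
- by exists e; apply: sub_hull.
Qed.

Lemma in_M_union G a H b : in_M (G, a) -> in_M (H, b) ->
  in_M (union G (translate a H), a ++ b).
Proof.
move=> [/= sG [fGV fGE] [G0 accG] [e Ge] Ga].
move=> [/= sH [fHV fHE] [H0 accH] _ Hb]; split => /=.
- split=> [//|e' [Ge'|[e2 He2 <-]]|e' [Ge'|[e2 He2 <-]]].
  + by case: sG => _ + _; apply.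
  + rewrite (cay_tgt sH He2) -/(shift _ _) shift_cay.
    by exists (a ++ src e2), e2.1.2.
  + by case: sG => _ _ /(_ _ Ge') []; split; left.
  + by case: sH => _ _ /(_ _ He2) [Hs Ht]; split; right;
      [exists (src e2)|exists (tgt e2)].
- by split; rewrite finite_setU; split => //; exact: finite_image.
- split; first by left.
  have accG' v : verts G v -> reachable (union G (translate a H)) [::] v.
    by move=> /accG; apply: reachable_sub => ? ?; left.
  move=> v [/accG' //|[w Hw <-]]; apply: rt_trans (accG' _ Ga) _.
  have := reachable_translate a (accH _ Hw); rewrite cats0.
  by apply: reachable_sub => ? ?; right.
- by exists e; left.
- by right; exists b.
Qed.

Lemma in_M_edge (y : label X) : in_M (edge_graph y, label_word y).
Proof.
split=> /=.
- split=> //= e ->; first by exists [::], y.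
  by split; [left|right].
- by split; [exact: finite_set2|exact: finite_set1].
- split; first by left.
  by move=> v [->|->]; [exact: rt_refl|apply: rt_step; exists y].
- by exists (cay_edge [::] y).
- by right.
Qed.

Lemma in_M_root G a : in_M (G, a) -> in_M (G, [::]).
Proof. by case=> sG fG [G0 acc] eG _; split. Qed.

Lemma in_M_rho_closure G a : in_M (G, a) -> rho_closure G = hull G.
Proof. by case=> sG fG _ _ _; apply: rho_closureE. Qed.

Lemma rho_closedP G a : in_M (G, a) -> rho_closed G <-> saturated (edges G).
Proof.
move=> /in_M_rho_closure GE; rewrite /rho_closed GE.
split=> [->|/hull_id -> //]; exact: saturated_hull.
Qed.

End Closure.

(** * Arithmetic of strong F-restriction semigroups *)

Local Notation "x ** y" := (mul x y) (at level 40, left associativity).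

(** The natural order on projections, for a projection [e]; [g] stands for its
    projection [plus g], so that lower bounds range over the whole carrier. *)
Definition below (A : algebra) (g e : A) : Prop := plus g ** e = plus g.

Section StrongFRestriction.
Variables (B : algebra) (hB : strong_F_restriction B).
Implicit Types x y z s t e g : B.

Let rB : restriction_semigroup (@mul B) (@plus B) := sfr_restriction hB.
Let mA : associative (@mul B) := rs_assoc rB.
Let plusx x : plus x ** x = x := rs_plusx rB x.
Let plusC x y : plus x ** plus y = plus y ** plus x := rs_plusC rB x y.
Let plusM x y : plus (plus x ** y) = plus x ** plus y := rs_plusM rB x y.
Let ample x y : x ** plus y = plus (x ** y) ** x := rs_ample rB x y.

Lemma plus_mul_plus x : plus x ** plus x = plus x.
Proof. by rewrite -plusM plusx. Qed.

Lemma plus_plus x : plus (plus x) = plus x.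
Proof. by rewrite -{1}(plus_mul_plus x) plusM plusC plusx. Qed.

Lemma plus_mul_below x y : plus (x ** y) ** plus x = plus (x ** y).
Proof. by rewrite plusC -plusM mA plusx. Qed.

Lemma plus_mulr x y : plus (x ** plus y) = plus (x ** y).
Proof. by rewrite ample plusM plus_mul_below. Qed.

Lemma natural_le_anti s t :
  natural_le (@mul B) (@plus B) s t -> natural_le (@mul B) (@plus B) t s ->
  s = t.
Proof.
case=> _ [a _ <-] sE [_ [b _ <-] tE].
have as_s : plus a ** s = s by rewrite sE mA plus_mul_plus.
by rewrite tE -{2}as_s mA plusC -mA -tE.
Qed.

Lemma plus_inj_below x y : below x (plus y) -> below y (plus x) ->
  plus x = plus y.
Proof. by rewrite /below plusC => xy yx; rewrite -[LHS]xy. Qed.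

Lemma below_refl x : below x (plus x).
Proof. exact: plus_mul_plus. Qed.

Lemma below_meet g x y :
  below g (plus x ** plus y) <-> below g (plus x) /\ below g (plus y).
Proof.
rewrite /below; split=> [<-|[gx gy]]; last by rewrite mA gx gy.
split; last by rewrite -!mA plus_mul_plus.
by rewrite -!mA [plus y ** _]plusC [plus x ** (_ ** _)]mA plus_mul_plus.
Qed.

Lemma below_trans g x y : below g (plus x) -> below x (plus y) ->
  below g (plus y).
Proof. by rewrite /below => gx xy; rewrite -gx -mA xy. Qed.

Lemma plus_lam : plus (lam B) = lam B.
Proof. by case: (sfr_lam hB) => [[x _ <-] _]; rewrite plus_plus. Qed.

Lemma mul_plus_lam x : plus x ** lam B = plus x.
Proof.
have [|_ [y _ <-] xE] := proj2 (sfr_lam hB) (plus x); first by exists x.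
have ll : lam B ** lam B = lam B by rewrite -plus_lam plus_mul_plus.
by rewrite xE -mA ll.
Qed.

Lemma mul_lam_l x : lam B ** x = x.
Proof.
by rewrite -{1}[x]plusx mA -plus_lam plusC plus_lam mul_plus_lam plusx.
Qed.

Lemma sigma_sym s t : sigma (@mul B) (@plus B) s t ->
  sigma (@mul B) (@plus B) t s.
Proof.
by move=> st r cr ir; case: (cong_equiv cr) => _ _; apply; apply: st.
Qed.

Lemma sigma_trans s t u : sigma (@mul B) (@plus B) s t ->
  sigma (@mul B) (@plus B) t u -> sigma (@mul B) (@plus B) s u.
Proof.
move=> st tu r cr ir; case: (cong_equiv cr) => _ tr _.
exact: tr (st r cr ir) (tu r cr ir).
Qed.

Lemma sigma_plus_mul x s : sigma (@mul B) (@plus B) (plus x ** s) s.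
Proof.
apply/(sigmaP rB); exists (plus x); first by exists x.
by rewrite mA plus_mul_plus.
Qed.

Lemma sigma_mmax s : sigma (@mul B) (@plus B) s (mmax s).
Proof. by case: (sfr_mmax hB s). Qed.

Lemma mmax_sigma s t : sigma (@mul B) (@plus B) s t -> mmax s = mmax t.
Proof.
move=> st; case: (sfr_mmax hB s) (sfr_mmax hB t) => [ss smax] [tt tmax].
apply: natural_le_anti.
  by apply: tmax; apply: sigma_trans (sigma_sym st) ss.
by apply: smax; apply: sigma_trans st tt.
Qed.

Lemma mmax_plus_mul x s : mmax (plus x ** s) = mmax s.
Proof. exact: mmax_sigma (sigma_plus_mul x s). Qed.

Lemma mmax_mmax s : mmax (mmax s) = mmax s.
Proof. by symmetry; apply: mmax_sigma; apply: sigma_mmax. Qed.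

Lemma plus_mmax s : plus s ** mmax s = s.
Proof.
have [ss smax] := sfr_mmax hB s.
have /smax [_ [x _ <-] sE] : sigma (@mul B) (@plus B) s s.
  exact: sigma_trans ss (sigma_sym ss).
by rewrite {1}sE plusM -mA plusx -sE.
Qed.

Lemma mmax_lam : mmax (lam B) = lam B.
Proof. by have := plus_mmax (lam B); rewrite plus_lam mul_lam_l. Qed.

(** Strongness, applied to the pair [s], [lam B], turns the left identity into a
    two-sided one. *)
Lemma mul_lam_r x : x ** lam B = x.
Proof.
have xl : mmax (x ** lam B) = mmax x.
  by rewrite -plus_lam ample mmax_plus_mul.
have := sfr_strong hB x (lam B); rewrite mmax_lam xl plusx => tl.
by rewrite -{1}[x]plus_mmax -mA tl plus_mmax.
Qed.

End StrongFRestriction.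

(** * Evaluation of words, edges and graphs *)

Section Values.
Variables (X : Type) (B : algebra) (f : X -> B).

Definition word_value (w : word X) : B := foldr (fun x b => f x ** b) (lam B) w.

Definition top (w : word X) : B := mmax (word_value w).

Definition label_value (y : label X) : B :=
  match y with inl x => f x | inr u => top u end.

(** If elements are thought of as partial maps composed from left to right, with
    [plus] giving the domain, a path to the source of [e] evaluates to a
    restriction of [top (src e)], and this projection is the restriction
    that makes the step along [e] possible. *)
Definition edge_value (e : edge X) : B := plus (top (src e) ** label_value e.1.2).

Definition edges_value (s : seq (edge X)) : B :=
  foldr (fun e b => edge_value e ** b) (lam B) s.

Hypothesis hB : strong_F_restriction B.
Let rB : restriction_semigroup (@mul B) (@plus B) := sfr_restriction hB.
Let mA : associative (@mul B) := rs_assoc rB.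
Let plusx (x : B) : plus x ** x = x := rs_plusx rB x.
Let plusC (x y : B) : plus x ** plus y = plus y ** plus x := rs_plusC rB x y.
Let plusM (x y : B) : plus (plus x ** y) = plus x ** plus y := rs_plusM rB x y.
Let ample (x y : B) : x ** plus y = plus (x ** y) ** x := rs_ample rB x y.

Lemma word_value_cat u v : word_value (u ++ v) = word_value u ** word_value v.
Proof. by elim: u => [|x u IH] /=; rewrite ?(mul_lam_l hB) // IH mA. Qed.

Lemma top_nil : top [::] = lam B.
Proof. exact: mmax_lam. Qed.

Lemma top_mul u v : top u ** top v = plus (top u) ** top (u ++ v).
Proof. by rewrite /top word_value_cat (sfr_strong hB). Qed.

Lemma mmax_top u : mmax (top u) = top u.
Proof. exact: mmax_mmax. Qed.

Lemma gen_top x : plus (f x) ** top [:: x] = f x.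
Proof. by rewrite /top /= (mul_lam_r hB) (plus_mmax hB). Qed.

Lemma plus_edge_value e : plus (edge_value e) = edge_value e.
Proof. exact: plus_plus. Qed.

Lemma edge_value_bar w u :
  edge_value (bedge w u) = plus (top w) ** plus (top (w ++ u)).
Proof. by rewrite /edge_value /= top_mul plusM. Qed.

(** The letter [f x] is a restriction of [top [:: x]], so fewer steps are possible
    along it than along its copy. *)
Lemma edge_value_gen w x :
  below (edge_value (xedge w x)) (edge_value (bedge w [:: x])).
Proof.
rewrite /below plus_edge_value /edge_value /=.
by rewrite -[in RHS](gen_top x) mA [in RHS]ample -mA plusM.
Qed.

(** Strongness makes the value of a copied edge depend on its endpoints only,
    and symmetrically, so lower bounds of values pass along the transformations
    of copied edges; the passage from a letter to its copy is
    [edge_value_gen]. *)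
Lemma saturated_below g : saturated [set e | below g (edge_value e)].
Proof.
split=> /= [v u|v x|w u v|w u v]; rewrite ?edge_value_bar ?cats0.
- by move=> /(below_meet hB) [gv _]; apply/(below_meet hB).
- rewrite -edge_value_bar -[edge_value (xedge _ _)]plus_edge_value => gx.
  rewrite -plus_edge_value; apply: (below_trans hB gx).
  rewrite plus_edge_value; exact: edge_value_gen.
- rewrite catA => /(below_meet hB) [gw _] /(below_meet hB) [_ gwuv].
  exact/(below_meet hB).
- rewrite catA => /(below_meet hB) [_ gwu] /(below_meet hB) [_ gwuv].
  exact/(below_meet hB).
Qed.

(** This turns the translation of graphs into multiplication; the factor
    [plus (top a)] disappears next to a graph that has [a] as a vertex. *)
Lemma top_mul_edge_value a e :
  plus (top a ** edge_value e) = plus (top a) ** edge_value (shift a e).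
Proof.
by rewrite /edge_value plus_mulr // mA top_mul -mA plusM.
Qed.

Lemma plus_edges_value s : plus (edges_value s) = edges_value s.
Proof.
elim: s => [|e s IH] /=; first exact: plus_lam.
by rewrite -{1}plus_edge_value plusM IH plus_edge_value.
Qed.

Lemma below_edges_value g s :
  below g (edges_value s) <-> forall e, List.In e s -> below g (edge_value e).
Proof.
elim: s => [|e s IH] /=; first by split=> // _; exact: mul_plus_lam.
rewrite -plus_edge_value -plus_edges_value below_meet //.
rewrite plus_edge_value plus_edges_value IH; split=> [[ge gs] e' [<-//|/gs]//|gs].
by split=> [|e' s_e']; apply: gs; [left|right].
Qed.

Lemma below_mul_edges_value g x s :
  below g (plus (x ** edges_value s)) <->
  below g (plus x) /\ forall e, List.In e s -> below g (plus (x ** edge_value e)).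
Proof.
elim: s => [|e s IH] /=; first by rewrite (mul_lam_r hB); split=> [|[]].
rewrite mA -[edge_value e]plus_edge_value ample -mA plusM below_meet // IH.
split=> [[ge [gx gs]]|[gx gs]].
  by split=> // e' [<-//|/gs].
split; first by apply: gs; left.
by split=> // e' s_e'; apply: gs; right.
Qed.

End Values.

Section ValuesMorphism.
Variables (X : Type) (A B : algebra) (f : X -> A) (h : A -> B).
Hypothesis hM : morphism h.

Lemma morphism_word_value w : h (word_value f w) = word_value (h \o f) w.
Proof. by elim: w => [|x w IH] /=; rewrite ?(mor_lam hM) // (mor_mul hM) IH. Qed.

Lemma morphism_top w : h (top f w) = top (h \o f) w.
Proof. by rewrite /top (mor_mmax hM) morphism_word_value. Qed.

Lemma morphism_edges_value s : h (edges_value f s) = edges_value (h \o f) s.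
Proof.
elim: s => [|e s IH] /=; rewrite ?(mor_lam hM) // (mor_mul hM) IH.
rewrite /edge_value (mor_plus hM) (mor_mul hM) morphism_top.
by case: e.1.2 => //= u; rewrite morphism_top.
Qed.

End ValuesMorphism.

(** * The algebra of closed pairs *)

Section ClosedPairs.
Variable X : Type.
Implicit Types (s t : closed_pair X) (G H : graph X) (a b w : word X).

Lemma closure_pairP G a : in_M (G, a) ->
  in_M (rho_closure G, a) /\ rho_closed (rho_closure G).
Proof.
move=> GM; have hM := in_M_hull GM; rewrite (in_M_rho_closure GM); split=> //.
exact/(rho_closedP hM)/saturated_hull.
Qed.

Definition closure_pair G a (GM : in_M (G, a)) : closed_pair X :=
  exist _ (rho_closure G, a) (closure_pairP GM).

Definition cp_graph s : graph X := (sval s).1.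
Definition cp_word s : word X := (sval s).2.

Lemma cp_in_M s : in_M (cp_graph s, cp_word s).
Proof. exact: (proj1 (svalP s)). Qed.

Lemma cp_saturated s : saturated (edges (cp_graph s)).
Proof. exact/(rho_closedP (cp_in_M s))/(proj2 (svalP s)). Qed.

Lemma pair_lamP : in_M (@pair_lam X) /\ rho_closed (@pair_lam X).1.
Proof.
have lM := in_M_edge (@inr X _ [::]); split=> //; apply/(rho_closedP lM).
split=> [v u|v x|w u v|w u v]; rewrite /edge_graph /bedge /xedge /cay_edge /=.
- by case=> -> _ _.
- by case.
- by case=> -> -> _; case=> ->.
- by case=> -> -> _ /=; case=> ->.
Qed.

Definition cp_mul s t : closed_pair X :=
  closure_pair (in_M_union (cp_in_M s) (cp_in_M t)).
Definition cp_plus s : closed_pair X :=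
  exist _ (pair_plus (sval s)) (conj (in_M_root (cp_in_M s)) (proj2 (svalP s))).
Definition cp_mmax s : closed_pair X :=
  closure_pair (in_M_edge (inr (cp_word s))).
Definition cp_lam : closed_pair X := exist _ pair_lam pair_lamP.
Definition cp_gen (x : X) : closed_pair X := closure_pair (in_M_edge (inl x)).

Definition cp_algebra : algebra := Algebra cp_mul cp_plus cp_mmax cp_lam.

Lemma cp_algebraP : closed_pair_algebra cp_mul cp_plus cp_mmax cp_lam cp_gen.
Proof. by []. Qed.

Lemma closed_pair_eq s t : cp_graph s = cp_graph t -> cp_word s = cp_word t ->
  s = t.
Proof.
case: s t => [[G a] GP] [[H b] HP]; rewrite /cp_graph /cp_word /= => GH ab.
by apply: eq_exist; rewrite GH ab.
Qed.

Lemma cp_graph_mul s t : cp_graph (cp_mul s t) =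
  hull (union (cp_graph s) (translate (cp_word s) (cp_graph t))).
Proof. exact: in_M_rho_closure (in_M_union (cp_in_M s) (cp_in_M t)). Qed.

Lemma cp_graph_mmax s :
  cp_graph (cp_mmax s) = hull (edge_graph (inr (cp_word s))).
Proof. exact: in_M_rho_closure (in_M_edge _). Qed.

Lemma cp_graph_gen x : cp_graph (cp_gen x) = hull (edge_graph (inl x)).
Proof. exact: in_M_rho_closure (in_M_edge _). Qed.

Lemma cp_graph_plus_mul s t : cp_graph (cp_mul (cp_plus s) t) =
  hull (union (cp_graph s) (cp_graph t)).
Proof. by rewrite cp_graph_mul translate0. Qed.

Lemma hull_cp_graph s : hull (cp_graph s) = cp_graph s.
Proof. exact: hull_id (cp_saturated s). Qed.

Lemma cp_bar_edge s v : verts (cp_graph s) v -> edges (cp_graph s) (bedge [::] v).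
Proof. exact: bar_edge (cp_in_M s) (cp_saturated s) v. Qed.

Lemma cp_word_vert s : verts (cp_graph s) (cp_word s).
Proof. by case: (cp_in_M s). Qed.

Lemma cp_root_vert s : verts (cp_graph s) [::].
Proof. by case: (cp_in_M s) => _ _ []. Qed.

Lemma cp_endpoints s e : edges (cp_graph s) e ->
  verts (cp_graph s) (src e) /\ verts (cp_graph s) (tgt e).
Proof. by case: (cp_in_M s) => [[_ _ +] _ _ _ _]; apply. Qed.

Lemma cp_absorb s G : edges G `<=` edges (cp_graph s) ->
  (forall v, verts G v -> verts (cp_graph s) v) ->
  hull (union (cp_graph s) G) = cp_graph s.
Proof.
move=> Es Vs; rewrite -[RHS]hull_cp_graph; apply: hull_eq => /=.
- by apply/seteqP; split=> v; [case=> // /Vs|move=> sv; left].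
- by move=> e [|/Es]; apply: sub_hull.
- by move=> e se E _ GE; apply: GE; left.
Qed.

Lemma cp_restriction : restriction_semigroup cp_mul cp_plus.
Proof.
split.
- move=> r s t; apply: closed_pair_eq; last exact: catA.
  rewrite !cp_graph_mul hull_unionl hull_union_translate.
  by rewrite translate_union -translate_cat unionA.
- move=> s; apply: closed_pair_eq => //.
  by rewrite cp_graph_plus_mul unionid hull_cp_graph.
- move=> s t; apply: closed_pair_eq => //.
  by rewrite !cp_graph_plus_mul unionC.
- move=> s t; apply: closed_pair_eq => //.
- move=> s t; apply: closed_pair_eq; last by rewrite /cp_word /= cats0.
  rewrite cp_graph_plus_mul !cp_graph_mul hull_unionl.
  by rewrite [union _ (cp_graph s)]unionC unionA unionid.
Qed.

(** Multiplying two pairs that have the same second component by the join of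
    their graphs makes them equal. *)
Lemma cp_sigmaP s t : sigma cp_mul cp_plus s t <-> cp_word s = cp_word t.
Proof.
split=> [/(sigmaP cp_restriction) [_ [r _ <-]]|st].
  by move/(congr1 cp_word).
apply/(sigmaP cp_restriction); exists (cp_plus (cp_mul (cp_plus s) t)).
  by exists (cp_mul (cp_plus s) t).
apply: closed_pair_eq; last exact: st.
rewrite !cp_graph_plus_mul !hull_unionl -[in RHS]unionA unionid.
by rewrite unionC unionA unionid.
Qed.

Lemma cp_le_mmax s t : cp_word s = cp_word t ->
  natural_le cp_mul cp_plus s (cp_mmax t).
Proof.
move=> st; exists (cp_plus s); first by exists s.
apply: closed_pair_eq; last exact: st.
rewrite cp_graph_plus_mul cp_graph_mmax hull_unionr cp_absorb // -st.
- by move=> _ ->; apply/cp_bar_edge/cp_word_vert.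
- by move=> v [->|->]; [apply: cp_root_vert|apply: cp_word_vert].
Qed.

Lemma cp_strong s t : cp_mul (cp_mmax s) (cp_mmax t) =
  cp_mul (cp_plus (cp_mmax s)) (cp_mmax (cp_mul s t)).
Proof.
apply: closed_pair_eq => //; rewrite cp_graph_plus_mul cp_graph_mul.
rewrite !cp_graph_mmax hull_unionr !hull_unionl hull_union_translate.
exact: hull_union_bar.
Qed.

Lemma cp_strong_F_restriction : strong_F_restriction cp_algebra.
Proof.
split=> /=.
- exact: cp_restriction.
- move=> s; split; first exact/cp_sigmaP.
  by move=> u /cp_sigmaP us; apply: cp_le_mmax.
- split; first by exists cp_lam => //; apply: closed_pair_eq.
  move=> _ [s _ <-].
  have -> : cp_lam = cp_mmax (cp_plus s).
    by apply: closed_pair_eq => //; rewrite cp_graph_mmax -[LHS]hull_cp_graph.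
  exact: cp_le_mmax.
- exact: cp_strong.
Qed.

(** Inclusion of edges suffices, because a closed graph has an edge ending at each
    of its vertices. *)
Lemma cp_belowP s t : below (A := cp_algebra) s (cp_plus t) <->
  edges (cp_graph t) `<=` edges (cp_graph s).
Proof.
split=> [st|ts].
  have sE : cp_graph (cp_mul (cp_plus s) (cp_plus t)) = cp_graph s.
    exact: (congr1 cp_graph st).
  by move=> e te; rewrite -sE cp_graph_plus_mul; apply: sub_hull; right.
apply: closed_pair_eq => //; rewrite [LHS]cp_graph_plus_mul cp_absorb //.
by move=> v /cp_bar_edge /ts /cp_endpoints [].
Qed.

Lemma cp_word_value w : cp_word (word_value (B := cp_algebra) cp_gen w) = w.
Proof. by elim: w => //= x w IH; rewrite -[RHS]/([:: x] ++ w) -{2}IH. Qed.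

Lemma cp_top w :
  cp_graph (top (B := cp_algebra) cp_gen w) = hull (edge_graph (inr w)).
Proof. by rewrite [LHS]cp_graph_mmax cp_word_value. Qed.

Lemma cp_word_top w : cp_word (top (B := cp_algebra) cp_gen w) = w.
Proof. exact: cp_word_value. Qed.

Lemma cp_label_value y :
  cp_graph (label_value (B := cp_algebra) cp_gen y) = hull (edge_graph y).
Proof. by case: y => [x|u]; [exact: cp_graph_gen|exact: cp_top]. Qed.

Lemma cp_edge_value e : cp_graph (edge_value (B := cp_algebra) cp_gen e) =
  hull (union (edge_graph (inr (src e)))
              (translate (src e) (edge_graph e.1.2))).
Proof.
rewrite [LHS]cp_graph_mul cp_top cp_label_value cp_word_top.
by rewrite hull_unionl hull_union_translate.
Qed.

(** The value of an edge [e] starting at [w] is generated by [e] and by the copied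
    edge from the root to [w], and both of them lie in [s]. *)
Lemma cp_edges_value s (l : seq (edge X)) :
  (forall e, edges (cp_graph s) e <-> List.In e l) ->
  edges_value (B := cp_algebra) cp_gen l = cp_plus s.
Proof.
move=> sl; have hA := cp_strong_F_restriction.
set D := edges_value _ _; have DE : plus D = D := plus_edges_value _ hA l.
rewrite -DE; apply: (plus_inj_below hA (x := D) (y := s)).
- apply/cp_belowP => e se.
  have /(below_edges_value _ hA) : below (A := cp_algebra) D D.
    by rewrite -[X in below _ X]DE; exact: (below_refl hA).
  move=> /(_ e); rewrite -sl -plus_edge_value // => /(_ se) /cp_belowP.
  apply; rewrite cp_edge_value; apply: sub_hull; right.
  have [sG _ _ _ _] := cp_in_M s.
  exists (cay_edge [::] e.1.2) => //.
  by rewrite -/(shift _ _) shift_cay cats0 -(cay_tgt sG se).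
- rewrite DE; apply/(below_edges_value _ hA) => e /sl se.
  rewrite -plus_edge_value //; apply/cp_belowP; rewrite cp_edge_value.
  have [sG _ _ _ _] := cp_in_M s.
  apply: hull_sub (cp_saturated s) _ => _ [->|[_ -> <-]].
    by apply: cp_bar_edge; case: (cp_endpoints se).
  by rewrite -/(shift _ _) shift_cay cats0 -(cay_tgt sG se).
Qed.

Lemma cp_decompose s :
  cp_mul (cp_plus s) (top (B := cp_algebra) cp_gen (cp_word s)) = s.
Proof.
apply: closed_pair_eq; last exact: cp_word_top.
rewrite cp_graph_plus_mul cp_top hull_unionr cp_absorb //.
- by move=> _ ->; apply/cp_bar_edge/cp_word_vert.
- by move=> v [->|->]; [apply: cp_root_vert|apply: cp_word_vert].
Qed.

End ClosedPairs.

(** * The universal property *)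

Lemma cp_edges_list (X : Type) (s : closed_pair X) :
  exists l : seq (edge X), forall e, edges (cp_graph s) e <-> List.In e l.
Proof. by apply: finite_set_list; case: (cp_in_M s) => _ []. Qed.

Section Extension.
Variables (X : Type) (B : algebra) (f : X -> B).
Hypothesis hB : strong_F_restriction B.
Implicit Types s t : closed_pair X.

Let mA : associative (@mul B) := rs_assoc (sfr_restriction hB).

Definition graph_value s : B := edges_value f (sval (cid (cp_edges_list s))).

Definition extension s : B := graph_value s ** top f (cp_word s).

Lemma plus_graph_value s : plus (graph_value s) = graph_value s.
Proof. exact: plus_edges_value. Qed.

(** Describing the value of a graph by its lower bounds frees it from the chosen
    enumeration of the edges. *)
Lemma below_graph_value g s : below g (graph_value s) <->
  edges (cp_graph s) `<=` [set e | below g (edge_value f e)].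
Proof.
rewrite /graph_value; case: cid => l /= sl; rewrite below_edges_value //.
by split=> gs e /sl /gs.
Qed.

Lemma below_hull_graph_value g s G : cp_graph s = hull G ->
  below g (graph_value s) <-> edges G `<=` [set e | below g (edge_value f e)].
Proof.
move=> sE; rewrite below_graph_value sE; split=> [gs e /sub_hull /gs //|].
exact: hull_sub (saturated_below f hB g).
Qed.

Lemma graph_value_eq s x :
  (forall g, below g (graph_value s) <-> below g (plus x)) ->
  graph_value s = plus x.
Proof.
move=> sx; rewrite -plus_graph_value; apply: plus_inj_below => //.
  by apply/sx; rewrite -{2}plus_graph_value; apply: below_refl.
by rewrite plus_graph_value; apply/sx; apply: below_refl.
Qed.

Lemma graph_value_edge s y : cp_graph s = hull (edge_graph y) ->
  graph_value s = plus (label_value f y).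
Proof.
move=> sE; apply: graph_value_eq => g; rewrite (below_hull_graph_value _ sE).
have -> : plus (label_value f y) = edge_value f (cay_edge [::] y).
  by rewrite /edge_value /= top_nil // mul_lam_l.
by split=> [/(_ _ erefl)|gy _ ->].
Qed.

Lemma graph_value_below_top s a : verts (cp_graph s) a ->
  below (graph_value s) (plus (top f a)).
Proof.
move=> /cp_bar_edge sa; have : below (graph_value s) (graph_value s).
  by rewrite -{2}plus_graph_value; apply: below_refl.
move=> /below_graph_value /(_ _ sa) /=; rewrite edge_value_bar //.
by move=> /(below_meet hB) [].
Qed.

Lemma graph_value_mul s t : graph_value (cp_mul s t) =
  plus (graph_value s ** (top f (cp_word s) ** graph_value t)).
Proof.
apply: graph_value_eq => g.
rewrite (below_hull_graph_value _ (cp_graph_mul s t)).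
rewrite -[X in plus (X ** _)]plus_graph_value.
rewrite (rs_plusM (sfr_restriction hB)) plus_graph_value.
rewrite -[X in X ** plus _]plus_graph_value below_meet // plus_graph_value.
rewrite below_graph_value /graph_value; case: cid => l /= tl.
rewrite below_mul_edges_value //; split=> [gst|[gs [ga gt]] e].
  have gs : edges (cp_graph s) `<=` [set e | below g (edge_value f e)].
    by move=> e se; apply: gst; left.
  have ga : below g (plus (top f (cp_word s))).
    apply: (below_trans hB (x := graph_value s)).
      by rewrite plus_graph_value; apply/below_graph_value.
    by apply: graph_value_below_top; apply: cp_word_vert.
  do 2 split => //; move=> e /tl te.
  rewrite top_mul_edge_value // -plus_edge_value // below_meet //.
  rewrite plus_edge_value //; split=> //.
  by apply: gst; right; exists e.
case=> [/gs //|[e' /tl /gt ge' <-]].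
move: ge'; rewrite top_mul_edge_value // -plus_edge_value // below_meet //.
by rewrite plus_edge_value // => -[].
Qed.

Lemma plus_extension s : plus (extension s) = graph_value s.
Proof.
rewrite /extension -plus_graph_value (rs_plusM (sfr_restriction hB)).
exact: graph_value_below_top (cp_word_vert s).
Qed.

Lemma extension_gen x : extension (cp_gen x) = f x.
Proof.
rewrite /extension (graph_value_edge (cp_graph_gen x)).
exact: gen_top.
Qed.

Lemma extension_morphism : morphism (A := cp_algebra X) extension.
Proof.
have rB := sfr_restriction hB.
split=> /= [s t|s|s|].
- rewrite /extension graph_value_mul -[X in plus (X ** _)]plus_graph_value.
  rewrite (rs_plusM rB) plus_graph_value.
  set a := cp_word s; set Q := graph_value t.
  have aQ : top f a ** Q = plus (top f a ** Q) ** top f a.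
    by rewrite -{1}[Q]plus_graph_value (rs_ample rB).
  rewrite [RHS]mA -[in RHS](mA _ (top f a)) {2}aQ -!mA top_mul //.
  by rewrite [in RHS](mA (plus (top f a ** Q))) plus_mul_below.
- rewrite plus_extension /extension top_nil // mul_lam_r //.
  rewrite -[RHS]plus_graph_value; apply: graph_value_eq => g.
  by rewrite plus_graph_value !below_graph_value.
- rewrite /extension (graph_value_edge (cp_graph_mmax s)) /= (rs_plusx rB).
  by rewrite -plus_graph_value mmax_plus_mul // mmax_top.
- rewrite /extension top_nil // mul_lam_r //.
  rewrite (graph_value_edge (y := inr [::])) /=.
    by rewrite top_nil // plus_lam.
  by rewrite -[LHS]hull_cp_graph.
Qed.

(** Every closed pair is an expression in the generators, namely its own value in
    the algebra of closed pairs; so a morphism is determined by its values on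
    the generators. *)
Lemma extension_unique (h : cp_algebra X -> B) :
  morphism h -> (forall x, h (cp_gen x) = f x) -> h = extension.
Proof.
move=> hM hf; apply/funext => s.
have hfE : h \o @cp_gen X = f by apply/funext.
rewrite -{1}[s]cp_decompose (mor_mul hM) morphism_top // hfE.
rewrite /extension /graph_value; case: cid => l /= sl.
by rewrite -(cp_edges_value sl) morphism_edges_value // hfE.
Qed.

End Extension.

Lemma cp_algebra_free (X : Type) : is_FFRs (A := cp_algebra X) (@cp_gen X).
Proof.
split; first exact: cp_strong_F_restriction.
move=> B hB f; exists (extension f); split.
  by split; [exact: extension_morphism|exact: extension_gen].
by move=> h [hM hf]; rewrite (extension_unique hM hf).
Qed.

Lemma morphism_comp (A B C : algebra) (g : A -> B) (h : B -> C) :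
  morphism g -> morphism h -> morphism (h \o g).
Proof.
move=> gM hM; split=> [s t|s|s|] /=.
- by rewrite (mor_mul gM) (mor_mul hM).
- by rewrite (mor_plus gM) (mor_plus hM).
- by rewrite (mor_mmax gM) (mor_mmax hM).
- by rewrite (mor_lam gM) (mor_lam hM).
Qed.

Lemma is_FFRs_endo (X : Type) (A : algebra) (i : X -> A) (h : A -> A) :
  is_FFRs i -> morphism h -> (forall x, h (i x) = i x) -> h = id.
Proof.
move=> [hA free] hM hi; have [k [_ kU]] := free A hA i.
by rewrite -(kU h) // -(kU id).
Qed.

Lemma is_FFRs_isomorphism (X : Type) (A B : algebra) (i : X -> A) (j : X -> B) :
  is_FFRs i -> is_FFRs j -> exists h : A -> B, canonical_isomorphism i j h.
Proof.
move=> iF jF.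
have [h [[hM hi] _]] := proj2 iF B (proj1 jF) j.
have [k [[kM kj] _]] := proj2 jF A (proj1 iF) i.
exists h; split=> //; exists k => x.
- rewrite -[LHS]/((k \o h) x) (is_FFRs_endo iF (morphism_comp hM kM)) // => y.
  by rewrite /= hi kj.
- rewrite -[LHS]/((h \o k) x) (is_FFRs_endo jF (morphism_comp kM hM)) // => y.
  by rewrite /= kj hi.
Qed.

Theorem proposition5p4 (X : Type) (hX : inhabited X) :
  exists (m : closed_pair X -> closed_pair X -> closed_pair X)
         (p mm : closed_pair X -> closed_pair X)
         (l : closed_pair X) (i : X -> closed_pair X),
    [/\ closed_pair_algebra m p mm l i,
        is_FFRs (A := Algebra m p mm l) i &
        forall (F : algebra) (j : X -> F), is_FFRs j ->
          exists h : Algebra m p mm l -> F,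
            canonical_isomorphism (A := Algebra m p mm l) i j h].
Proof.
exists (@cp_mul X), (@cp_plus X), (@cp_mmax X), (@cp_lam X), (@cp_gen X).
split; first exact: cp_algebraP; first exact: cp_algebra_free.
by move=> F j; apply: is_FFRs_isomorphism; apply: cp_algebra_free.
Qed.
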